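(* Let $R$ be a $G$-category and $P\colon R\to R/G$ the canonical functor. Then the pushdown $(P_\bullet,\phi_\bullet)\colon\operatorname{mod}R\to\operatorname{mod}R/G$ is a $G$-precovering, where $\operatorname{mod}R$ carries the $G$-action $X\mapsto{}^\alpha X$.
   Context: $\Bbbk$ is a commutative ring; all categories and functors are $\Bbbk$-linear; $G$ is a group. A $G$-category is a category $\mathcal C$ with a group homomorphism $G\to\operatorname{Aut}(\mathcal C)$, $\alpha\mapsto A_\alpha$, written $\alpha x,\alpha f$. For a $G$-invariant functor $(F,\phi)$ (natural isos $\phi_\alpha\colon F\to FA_\alpha$ with $\phi_1=\mathrm{id}$, $(\phi_\beta A_\alpha)\phi_\alpha=\phi_{\beta\alpha}$), it is a $G$-precovering if each $F^{(1)}_{x,y}\colon\bigoplus_\alpha\mathcal C(\alpha x,y)\to\mathcal C'(Fx,Fy)$, $(f_\alpha)\mapsto\sum F(f_\alpha)\phi_{\alpha,x}$, is bijective. $\operatorname{Mod}R$ is the category of contravariant $\Bbbk$-linear functors $R\to\operatorname{Mod}\Bbbk$; $\operatorname{mod}R$ is its full subcategory of finitely generated modules (quotients of finite direct sums of representables $R(-,x)$). $G$ acts on $\operatorname{Mod}R$ (and on $\operatorname{mod}R$) by ${}^\alpha X:=X\circ A_{\alpha^{-1}}$, ${}^\alpha u:=uA_{\alpha^{-1}}$. $R/G$: objects of $R$; morphisms $x\to y$ are row- and column-finite families $f=(f_{\beta,\alpha})_{(\alpha,\beta)\in G\times G}$ with $f_{\beta,\alpha}\in R(\alpha x,\beta y)$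 and $f_{\gamma\beta,\gamma\alpha}=\gamma(f_{\beta,\alpha})$; composition $(gf)_{\beta,\alpha}=\sum_\gamma g_{\beta,\gamma}f_{\gamma,\alpha}$. $Px=x$, $P(f)=(\delta_{\alpha,\beta}\alpha f)$. Pushdown: for $X\in\operatorname{Mod}R$, $(P_\bullet X)(x)=\bigoplus_{\alpha\in G}X(\alpha x)$, and for $f\colon x\to y$ in $R/G$, $(P_\bullet X)(f)\colon\bigoplus_\beta X(\beta y)\to\bigoplus_\alpha X(\alpha x)$ is the matrix with $(\alpha,\beta)$-entry $X(f_{\beta,\alpha})$; for $u\colon X\to X'$, $(P_\bullet u)_x=\bigoplus_\alpha u_{\alpha x}$. ($P_\bullet$ is left adjoint to $Y\mapsto Y\circ P$ and maps $\operatorname{mod}R$ into $\operatorname{mod}R/G$.) Its invariance adjuster: $(\phi_\bullet)_{\mu,X,x}\colon\bigoplus_\alpha X(\alpha x)\to(P_\bullet{}^\mu X)(x)=\bigoplus_\beta X(\mu^{-1}\beta x)$ maps the summand indexed by $\alpha$ identically onto the summand indexed by $\beta=\mu\alpha$. *)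

(* Defs.v *)
From HB Require Import structures.
From mathcomp Require Import all_boot all_algebra.
From Stdlib Require List.

Set Implicit Arguments.
Unset Strict Implicit.
Unset Printing Implicit Defensive.

Import GRing.Theory.
Local Open Scope ring_scope.

Record group := Group {
  gcar :> Type;
  gmul : gcar -> gcar -> gcar;
  gone : gcar;
  ginv : gcar -> gcar;
  gmulA : forall a b c, gmul a (gmul b c) = gmul (gmul a b) c;
  gmul1l : forall a, gmul gone a = a;
  gmulVl : forall a, gmul (ginv a) a = gone }.
Arguments gmul {g}.
Arguments gone {g}.
Arguments ginv {g}.

Definition castT (O : Type) (P : O -> Type) (a b : O) (e : a = b) (p : P a) : P b :=
  eq_rect a P p b e.
Arguments castT {O} P {a b} e p.

Definition castHom (O : Type) (H : O -> O -> Type) (x x' y y' : O)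
    (e1 : x = x') (e2 : y = y') (f : H x y) : H x' y' :=
  castT (fun a => H a y') e1 (castT (fun b => H x b) e2 f).
Arguments castHom {O} H {x x' y y'} e1 e2 f.

Definition FinSum (I : Type) (V : nmodType) (t : I -> V) (v : V) : Prop :=
  exists s : list I, List.NoDup s /\ (forall i, ~ List.In i s -> t i = 0)
                     /\ v = \sum_(i <- s) t i.

Definition DS (k : comPzRingType) (I : Type) (M : I -> lmodType k) :=
  {v : forall i, M i | exists s : list I, forall i, ~ List.In i s -> v i = 0}.

Record kcat (k : comPzRingType) := KCat {
  Obj : Type;
  Hom : Obj -> Obj -> lmodType k;
  idm : forall x, Hom x x;
  comp : forall x y z, Hom y z -> Hom x y -> Hom x z }.
Arguments Obj {k} _.
Arguments Hom {k} _ _ _.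
Arguments idm {k _} _.
Arguments comp {k _ _ _ _} _ _.

Definition is_kcat (k : comPzRingType) (C : kcat k) : Prop :=
  [/\ (forall x y z w (h : Hom C z w) (g : Hom C y z) (f : Hom C x y),
         comp h (comp g f) = comp (comp h g) f),
      (forall x y (f : Hom C x y), comp (idm y) f = f),
      (forall x y (f : Hom C x y), comp f (idm x) = f),
      (forall x y z (a : k) (g g' : Hom C y z) (f : Hom C x y),
         comp (a *: g + g') f = a *: comp g f + comp g' f) &
      (forall x y z (a : k) (g : Hom C y z) (f f' : Hom C x y),
         comp g (a *: f + f') = a *: comp g f + comp g f')].

(* alpha |-> A_alpha : act alpha on objects, amap alpha on morphisms *)
Record Gaction (k : comPzRingType) (G : group) (C : kcat k) := GAction {
  act : G -> Obj C -> Obj C;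
  amap : forall (al : G) x y, Hom C x y -> Hom C (act al x) (act al y) }.
Arguments act {k G C} _ _ _.
Arguments amap {k G C} _ _ {_ _} _.

Definition is_Gaction (k : comPzRingType) (G : group) (C : kcat k)
    (A : Gaction G C)
    (actM : forall (al be : G) x, act A be (act A al x) = act A (gmul be al) x) : Prop :=
  [/\ (forall al x y (a : k) (f f' : Hom C x y),
         amap A al (a *: f + f') = a *: amap A al f + amap A al f'),
      (forall al x, amap A al (idm x) = idm (act A al x)),
      (forall al x y z (g : Hom C y z) (f : Hom C x y),
         amap A al (comp g f) = comp (amap A al g) (amap A al f)),
      exists act1 : forall x, act A gone x = x,
        forall x y (f : Hom C x y),
          amap A gone f = castHom (Hom C) (esym (act1 x)) (esym (act1 y)) f &
      forall (al be : G) x y (f : Hom C x y),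
          amap A be (amap A al f)
          = castHom (Hom C) (esym (actM al be x)) (esym (actM al be y))
                    (amap A (gmul be al) f)].

(* The object-level law A_beta A_alpha = A_(beta alpha) is the (propositional)
   hypothesis actM, needed for transports; any proof will do. *)

(* ---------- (right) modules: contravariant k-linear functors C -> Mod k ---------- *)
Record rmod (k : comPzRingType) (C : kcat k) := RMod {
  mob : Obj C -> lmodType k;
  mmap : forall x y, Hom C x y -> mob y -> mob x }.
Arguments mob {k C} _ _.
Arguments mmap {k C} _ {_ _} _ _.

Definition is_rmod (k : comPzRingType) (C : kcat k) (M : rmod C) : Prop :=
  [/\ (forall x y (f : Hom C x y) (a : k) (v w : mob M y),
         mmap M f (a *: v + w) = a *: mmap M f v + mmap M f w),
      (forall x y (a : k) (f f' : Hom C x y) (v : mob M y),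
         mmap M (a *: f + f') v = a *: mmap M f v + mmap M f' v),
      (forall x (v : mob M x), mmap M (idm x) v = v) &
      (forall x y z (g : Hom C y z) (f : Hom C x y) (v : mob M z),
         mmap M (comp g f) v = mmap M f (mmap M g v))].

(* finitely generated: a quotient of a finite direct sum of representables
   (+)_{i<n} C(-, x_i); by Yoneda such an epimorphism is given by elements
   e_i in M(x_i) such that every element of every M(z) is of the form
   sum_i M(f_i)(e_i) with f_i : z -> x_i. *)
Definition fg (k : comPzRingType) (C : kcat k) (M : rmod C) : Prop :=
  exists (n : nat) (xs : 'I_n -> Obj C) (e : forall i, mob M (xs i)),
    forall z (v : mob M z),
      exists fs : forall i, Hom C z (xs i), v = \sum_(i < n) mmap M (fs i) (e i).

Definition is_nat (k : comPzRingType) (C : kcat k) (M N : rmod C)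
    (u : forall z, mob M z -> mob N z) : Prop :=
  (forall z (a : k) (v w : mob M z), u z (a *: v + w) = a *: u z v + u z w) /\
  (forall x y (f : Hom C x y) (v : mob M y), u x (mmap M f v) = mmap N f (u y v)).

Arguments is_nat {k C} M N u.
Arguments is_kcat {k} C.
Arguments is_Gaction {k G C} A actM.
Arguments is_rmod {k C} M.
Arguments fg {k C} M.

(* the G-action on Mod C: ^alpha M := M o A_(alpha^-1) *)
Definition twist (k : comPzRingType) (G : group) (C : kcat k) (A : Gaction G C)
    (al : G) (M : rmod C) : rmod C :=
  @RMod k C (fun z => mob M (act A (ginv al) z))
            (fun x y f => mmap M (amap A (ginv al) f)).
Arguments twist {k G C} A al M.

Unset Implicit Arguments.
Section Orbit.
Variables (k : comPzRingType) (G : group) (C : kcat k) (A : Gaction G C).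
Variable actM : forall (al be : G) x, act A be (act A al x) = act A (gmul be al) x.

(* morphisms x -> y of the orbit category C/G: families
   f al be = f_{be,al} in C(al x, be y), row- and column-finite, with
   f_{ga be, ga al} = ga (f_{be,al}). *)
Definition rg_hom (x y : Obj C) :=
  {f : forall al be : G, Hom C (act A al x) (act A be y) |
    [/\ (forall be : G, exists s : list G, forall al, ~ List.In al s -> f al be = 0),
        (forall al : G, exists s : list G, forall be, ~ List.In be s -> f al be = 0) &
        (forall ga al be : G,
           f (gmul ga al) (gmul ga be)
           = castHom (Hom C) (actM al ga x) (actM be ga y) (amap A ga (f al be)))]}.

(* underlying modules of the pushdown: (P. M)(x) = (+)_ga M(ga x) *)
Definition PD (M : rmod C) (x : Obj C) := DS (fun ga : G => mob M (act A ga x)).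

(* u = (u_x)_x is a morphism P.X -> P.Y in Mod C/G, where
   (P.M)(f) has matrix entries M(f_{be,al}) *)
Definition is_nat_PD (X Y : rmod C) (u : forall x, PD X x -> PD Y x) : Prop :=
  (forall x (a : k) (v w z : PD X x),
     (forall ga, sval z ga = a *: sval v ga + sval w ga) ->
     forall ga, sval (u x z) ga = a *: sval (u x v) ga + sval (u x w) ga) /\
  (forall x y (f : rg_hom x y) (v : PD X y) (w : PD X x),
     (forall al, FinSum (fun be => mmap X (sval f al be) (sval v be)) (sval w al)) ->
     forall al, FinSum (fun be => mmap Y (sval f al be) (sval (u y v) be))
                       (sval (u x w) al)).

(* elements of  (+)_mu Hom_{mod C}(^mu X, Y) *)
Definition in_dsum_hom (X Y : rmod C)
    (f : forall mu : G, forall z, mob (twist A mu X) z -> mob Y z) : Prop :=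
  (forall mu, is_nat (twist A mu X) Y (f mu)) /\
  (exists s : list G, forall mu, ~ List.In mu s -> forall z w, f mu z w = 0).

(* [F1rel f u]: u = F^(1)_{X,Y}(f) = sum_mu P.(f_mu) o (phi.)_{mu,X}, i.e.
   u_x(v)_be = sum_mu (f_mu)_{be x}(v_{mu^-1 be}), where (phi.)_{mu,X,x}
   sends the summand ga identically onto the summand mu ga. *)
Definition F1rel (X Y : rmod C)
    (f : forall mu : G, forall z, mob (twist A mu X) z -> mob Y z)
    (u : forall x, PD X x -> PD Y x) : Prop :=
  forall x (v : PD X x) (be : G),
    FinSum (fun mu : G =>
              f mu (act A be x)
                (castT (mob X) (esym (actM be (ginv mu) x))
                       (sval v (gmul (ginv mu) be))))
           (sval (u x v) be).

(* F^(1)_{X,Y} is a well-defined bijection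
   (+)_mu Hom(^mu X, Y) -> Hom_{mod C/G}(P.X, P.Y) *)
Definition F1_bijective (X Y : rmod C) : Prop :=
  [/\ (forall f, in_dsum_hom X Y f -> exists u, is_nat_PD X Y u /\ F1rel X Y f u),
      (forall u, is_nat_PD X Y u -> exists f, in_dsum_hom X Y f /\ F1rel X Y f u) &
      (forall f g u, in_dsum_hom X Y f -> in_dsum_hom X Y g ->
         F1rel X Y f u -> F1rel X Y g u -> forall mu z w, f mu z w = g mu z w)].
End Orbit.
Arguments rg_hom {k G C A} actM x y.
Arguments PD {k G C} A M x.
Arguments is_nat_PD {k G C A} actM X Y u.
Arguments in_dsum_hom {k G C} A X Y f.
Arguments F1rel {k G C A} actM X Y f u.
Arguments F1_bijective {k G C A} actM X Y.

(* Main.v *)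
From Pilot Require Import Defs.
From HB Require Import structures.
From mathcomp Require Import all_boot all_algebra.
From Stdlib Require Import ClassicalEpsilon FunctionalExtensionality ProofIrrelevance.
(* [vector] also exports a constructor [Hom]; let [Defs.Hom] take precedence. *)
Import Pilot.Defs.

Set Implicit Arguments.
Unset Strict Implicit.
Unset Printing Implicit Defensive.
Import GRing.Theory.
Local Open Scope ring_scope.

(* A morphism u : P.X -> P.Y is in particular natural with respect to the
   morphisms of R/G induced by morphisms x -> c y of R, and these shift the
   summands of the pushdown by c.  So the be-component of u(v) is the
   1-component of u applied to the shift of v by be, and splitting that vector
   into its summands writes u as F^(1)(f), where f_mu is the 1-component of u
   on the summand indexed by mu^-1.  The same formula shows that u determines
   f, and f is finitely supported because on each of the finitely many
   generators of X only finitely many f_mu are nonzero.  Conversely, F^(1)(f)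
   is natural because morphisms of R/G are G-equivariant matrices, which lets
   the defining sums be reindexed. *)

(* Equality on a group is decided classically, so that the finite supports of
   [Defs] can be handled with [seq] and [bigop]. *)
Definition classic_eqb (T : Type) (a b : T) : bool :=
  if excluded_middle_informative (a = b) then true else false.

Lemma classic_eqbP (T : Type) : Equality.axiom (@classic_eqb T).
Proof.
by move=> a b; rewrite /classic_eqb; case: excluded_middle_informative; constructor.
Qed.

HB.instance Definition _ (G : group) := hasDecEq.Build (gcar G) (@classic_eqbP G).

Section Lists.
Variable T : eqType.
Implicit Types (x : T) (s : seq T).

Lemma In_mem x s : List.In x s <-> x \in s.
Proof.
elim: s => [|y s IH] /=; first by [].
rewrite in_cons; split=> [[->|/IH->]|/orP[/eqP->|/IH]]; rewrite ?eqxx ?orbT; auto.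
Qed.

Lemma NoDup_uniq s : List.NoDup s <-> uniq s.
Proof.
elim: s => [|x s IH] /=; first by split=> // _; constructor.
rewrite List.NoDup_cons_iff; split=> [[Hx /IH->]|/andP[Hx /IH]]; last first.
  by split=> // /In_mem; apply/negP.
by rewrite andbT; apply/negP => /In_mem.
Qed.

Lemma notIn_mem x s : ~ List.In x s <-> x \notin s.
Proof. by rewrite In_mem; split=> /negP. Qed.
End Lists.

Section FinSums.
Variables (I : eqType) (V : nmodType).
Implicit Types (s : seq I) (t : I -> V).

Lemma FinSumP t v : FinSum t v <->
  exists s, [/\ uniq s, forall i, i \notin s -> t i = 0 & v = \sum_(i <- s) t i].
Proof.
split=> -[s].
  by move=> [/NoDup_uniq Us [Ht ->]]; exists s; split=> // i /notIn_mem/Ht.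
by move=> [/NoDup_uniq Us Ht ->]; exists s; split=> //; split=> // i /notIn_mem/Ht.
Qed.

Lemma big_uniq_support s s' t : uniq s -> uniq s' ->
  (forall i, i \notin s -> t i = 0) -> (forall i, i \notin s' -> t i = 0) ->
  \sum_(i <- s) t i = \sum_(i <- s') t i.
Proof.
have restrict (r r' : seq I) : (forall i, i \notin r' -> t i = 0) ->
    \sum_(i <- r) t i = \sum_(i <- [seq i <- r | i \in r']) t i.
  move=> H; rewrite big_filter [RHS]big_mkcond; apply: eq_bigr => i _.
  by case: ifP => // /negbT /H.
move=> Us Us' Ht Ht'; rewrite (restrict s s') // (restrict s' s) //.
apply: perm_big; apply: uniq_perm; rewrite ?filter_uniq // => i.
by rewrite !mem_filter andbC.
Qed.

Lemma FinSum_unique t v v' : FinSum t v -> FinSum t v' -> v = v'.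
Proof. by move=> /FinSumP[s [Us Ht ->]] /FinSumP[s' [Us' Ht' ->]]; apply: big_uniq_support. Qed.

Lemma eq_FinSum t t' v v' : t =1 t' -> v = v' -> FinSum t v -> FinSum t' v'.
Proof. by move=> /functional_extensionality -> ->. Qed.

Lemma FinSum1 t j : (forall i, i != j -> t i = 0) -> FinSum t (t j).
Proof.
by move=> Ht; apply/FinSumP; exists [:: j]; rewrite big_seq1; split=> // i; rewrite inE; apply: Ht.
Qed.

Lemma FinSum1_eq t j v : (forall i, i != j -> t i = 0) -> FinSum t v -> v = t j.
Proof. by move=> Ht /FinSum_unique; apply; apply: FinSum1. Qed.
End FinSums.

Section Linear.
Variables (k : comPzRingType) (V W : lmodType k) (h : V -> W).
Hypothesis h_linear : forall a v w, h (a *: v + w) = a *: h v + h w.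

Let hL : {linear V -> W} := HB.pack h (GRing.isLinear.Build k V W *:%R h h_linear).

Lemma lin0 : h 0 = 0. Proof. exact: (raddf0 hL). Qed.
Lemma lin_sum (J : Type) (r : seq J) (F : J -> V) :
  h (\sum_(j <- r) F j) = \sum_(j <- r) h (F j).
Proof. exact: (raddf_sum hL). Qed.
End Linear.

Section Transport.
Variables (O : Type) (P : O -> Type).

Lemma castT_pi (a b : O) (e e' : a = b) p : castT P e p = castT P e' p.
Proof. by rewrite (proof_irrelevance _ e e'). Qed.

Lemma castT_id (a : O) (e : a = a) p : castT P e p = p.
Proof. by rewrite (proof_irrelevance _ e erefl). Qed.

Lemma castT_trans (a b c : O) (e1 : a = b) (e2 : b = c) p :
  castT P e2 (castT P e1 p) = castT P (etrans e1 e2) p.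
Proof. by destruct e2. Qed.

Lemma castT_fam (O' : Type) (h : O' -> O) (a b : O') (e : a = b) p :
  castT (fun c => P (h c)) e p = castT P (f_equal h e) p.
Proof. by destruct e. Qed.

Lemma castT_dfun (O' : Type) (h : O' -> O) (F : forall c, P (h c)) (a b : O') (e : a = b) :
  F b = castT P (f_equal h e) (F a).
Proof. by destruct e. Qed.
End Transport.

Lemma castT_linear (k : comPzRingType) (O : Type) (P : O -> lmodType k) (a b : O) (e : a = b)
  (c : k) (v w : P a) : castT P e (c *: v + w) = c *: castT P e v + castT P e w.
Proof. by destruct e. Qed.

Lemma castT0 (k : comPzRingType) (O : Type) (P : O -> lmodType k) (a b : O) (e : a = b) :
  castT P e 0 = 0.
Proof. by destruct e. Qed.

Lemma castT_sum (k : comPzRingType) (O : Type) (P : O -> lmodType k) (a b : O) (e : a = b)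
  (J : Type) (r : seq J) (F : J -> P a) :
  castT P e (\sum_(j <- r) F j) = \sum_(j <- r) castT P e (F j).
Proof. by destruct e. Qed.

Lemma FinSum_cast (k : comPzRingType) (I O : Type) (P : O -> lmodType k) (a b : O) (e : a = b)
  (t : I -> P a) v : FinSum t v -> FinSum (fun i => castT P e (t i)) (castT P e v).
Proof. by destruct e. Qed.

Section HomTransport.
Variables (O : Type) (H : O -> O -> Type).

Lemma castHom_pi (x x' y y' : O) (e1 e1' : x = x') (e2 e2' : y = y') f :
  castHom H e1 e2 f = castHom H e1' e2' f.
Proof. by rewrite (proof_irrelevance _ e1 e1') (proof_irrelevance _ e2 e2'). Qed.

Lemma castHom_trans (x x' x'' y y' y'' : O)
  (a1 : x = x') (b1 : y = y') (a2 : x' = x'') (b2 : y' = y'') f :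
  castHom H a2 b2 (castHom H a1 b1 f) = castHom H (etrans a1 a2) (etrans b1 b2) f.
Proof. by destruct a1, a2, b1, b2. Qed.

End HomTransport.

Lemma castHom0 (k : comPzRingType) (C : kcat k) (x x' y y' : Obj C)
  (e1 : x = x') (e2 : y = y') : castHom (Hom C) e1 e2 0 = 0.
Proof. by destruct e1, e2. Qed.

Section GroupTheory.
Variable G : group.
Implicit Types a b : G.

Lemma gmulVr a : gmul a (ginv a) = gone.
Proof.
rewrite -[gmul a _]gmul1l -(gmulVl (ginv a)) -gmulA (gmulA (ginv a)) gmulVl gmul1l.
by rewrite gmulVl.
Qed.

Lemma gmul1r a : gmul a gone = a.
Proof. by rewrite -(gmulVl a) gmulA gmulVr gmul1l. Qed.

Lemma gmulKV a b : gmul a (gmul (ginv a) b) = b.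
Proof. by rewrite gmulA gmulVr gmul1l. Qed.

Lemma gmulVK a b : gmul (ginv a) (gmul a b) = b.
Proof. by rewrite gmulA gmulVl gmul1l. Qed.

Lemma gmulI a : injective (gmul a).
Proof. by move=> b c E; rewrite -(gmulVK a b) E gmulVK. Qed.

Lemma gmulKr a b : gmul (gmul b a) (ginv a) = b.
Proof. by rewrite -gmulA gmulVr gmul1r. Qed.

Lemma gmulIr a : injective (gmul^~ a).
Proof. by move=> b c E; rewrite -(gmulKr a b) E gmulKr. Qed.

Lemma ginvK : involutive (@ginv G).
Proof. by move=> a; apply: (@gmulI (ginv a)); rewrite gmulVr gmulVl. Qed.
End GroupTheory.

Unset Implicit Arguments.

Section Pushdown.
Variables (k : comPzRingType) (G : group) (C : kcat k) (A : Gaction G C).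
Variable actM : forall (al be : G) x, act A be (act A al x) = act A (gmul be al) x.
Variable act1 : forall x, act A gone x = x.
Hypothesis amap_linear : forall (al : G) x y (a : k) (f f' : Hom C x y),
  amap A al (a *: f + f') = a *: amap A al f + amap A al f'.
Hypothesis amapM : forall (al be : G) x y (f : Hom C x y),
  amap A be (amap A al f)
  = castHom (Hom C) (esym (actM al be x)) (esym (actM al be y)) (amap A (gmul be al) f).
Hypothesis amap_id : forall (al : G) x, amap A al (idm x) = idm (act A al x).
Hypothesis amap1 : forall x y (f : Hom C x y),
  amap A gone f = castHom (Hom C) (esym (act1 x)) (esym (act1 y)) f.

Lemma amap0 (al : G) x y : amap A al (0 : Hom C x y) = 0.
Proof. exact: lin0 (amap_linear al x y). Qed.

Lemma amap_castHom (ga : G) (x x' y y' : Obj C) (e1 : x = x') (e2 : y = y') (f : Hom C x y) :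
  amap A ga (castHom (Hom C) e1 e2 f)
  = castHom (Hom C) (f_equal (act A ga) e1) (f_equal (act A ga) e2) (amap A ga f).
Proof. by destruct e1, e2. Qed.

Lemma actVK (mu : G) x : act A (ginv mu) (act A mu x) = x.
Proof. by rewrite actM gmulVl act1. Qed.

Lemma actKV (mu : G) x : act A mu (act A (ginv mu) x) = x.
Proof. by rewrite actM gmulVr act1. Qed.

Lemma amap_idx (a b : G) (e : a = b) x y (f : Hom C x y) :
  amap A b f = castHom (Hom C) (f_equal (fun c => act A c x) e)
                 (f_equal (fun c => act A c y) e) (amap A a f).
Proof. by destruct e. Qed.

Lemma amapVK (mu : G) x y (f : Hom C x y) :
  amap A (ginv mu) (amap A mu f)
  = castHom (Hom C) (esym (actVK mu x)) (esym (actVK mu y)) f.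
Proof.
rewrite amapM (amap_idx _ _ (esym (gmulVl mu))) amap1 !castHom_trans; exact: castHom_pi.
Qed.

Section Modules.
Variables (M : rmod C) (HM : is_rmod M).

Lemma mmap0r x y (f : Hom C x y) : mmap M f 0 = 0.
Proof. by case: HM => H _ _ _; exact: lin0 (H x y f). Qed.

Lemma mmap0l x y (v : mob M y) : mmap M (0 : Hom C x y) v = 0.
Proof. by case: HM => _ H _ _; exact: (lin0 (fun a f f' => H x y a f f' v)). Qed.

Lemma mmap_sumr x y (f : Hom C x y) (J : Type) (s : seq J) (F : J -> mob M y) :
  mmap M f (\sum_(j <- s) F j) = \sum_(j <- s) mmap M f (F j).
Proof. by case: HM => H _ _ _; exact: (lin_sum (H x y f) s F). Qed.

Lemma mmap_castHom (x x' y y' : Obj C) (e1 : x = x') (e2 : y = y') (f : Hom C x y)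
  (v : mob M y') :
  mmap M (castHom (Hom C) e1 e2 f) v = castT (mob M) e1 (mmap M f (castT (mob M) (esym e2) v)).
Proof. by destruct e1, e2. Qed.

Lemma mmap_cast_idm (a b : Obj C) (e : a = b) (w : mob M b) :
  mmap M (castHom (Hom C) (erefl a) e (idm a)) w = castT (mob M) (esym e) w.
Proof. by destruct e; case: HM => _ _ H _; exact: H. Qed.

Lemma PD_ext z (v w : PD A M z) : (forall al, sval v al = sval w al) -> v = w.
Proof.
case: v w => [v Hv] [w Hw] /= /(functional_extensionality_dep _ _) E; subst w.
by rewrite (proof_irrelevance _ Hv Hw).
Qed.

Definition delta_fun z (ga : G) (w : mob M (act A ga z)) (al : G) : mob M (act A al z) :=
  if ga =P al is ReflectT e then castT (fun b => mob M (act A b z)) e w else 0.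

Lemma delta_fun_self z ga w : delta_fun z ga w ga = w.
Proof. by rewrite /delta_fun; case: eqP => [e|[]] //; rewrite castT_id. Qed.

Lemma delta_fun_ne z ga w al : ga != al -> delta_fun z ga w al = 0.
Proof. by rewrite /delta_fun; case: eqP. Qed.

Lemma delta_fun_linear z ga al a v w :
  delta_fun z ga (a *: v + w) al = a *: delta_fun z ga v al + delta_fun z ga w al.
Proof. by rewrite /delta_fun; case: eqP => [e|_]; rewrite ?castT_linear // scaler0 addr0. Qed.

Lemma delta_fun0 z ga al : delta_fun z ga 0 al = 0.
Proof. exact: (lin0 (fun a v w => delta_fun_linear z ga al a v w)). Qed.

Lemma delta_fun_support z ga w :
  exists s : seq G, forall al, ~ List.In al s -> delta_fun z ga w al = 0.
Proof. by exists [:: ga] => al /notIn_mem; rewrite inE eq_sym; apply: delta_fun_ne. Qed.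

Definition pd_delta z ga w : PD A M z := exist _ (delta_fun z ga w) (delta_fun_support z ga w).

Lemma pd_deltaE z ga w : sval (pd_delta z ga w) = delta_fun z ga w.
Proof. by []. Qed.

Lemma pd_delta_cast z (ga ga' : G) (e : ga = ga') w :
  pd_delta z ga' (castT (fun b => mob M (act A b z)) e w) = pd_delta z ga w.
Proof. by destruct e. Qed.

Lemma pd_sum_support z (s : seq G) (W : G -> PD A M z) :
  exists t : seq G, forall al, ~ List.In al t -> \sum_(ga <- s) sval (W ga) al = 0.
Proof.
elim: s => [|a s [t Ht]]; first by exists [::] => al _; rewrite big_nil.
case: (svalP (W a)) => ta Hta; exists (ta ++ t) => al Hal.
by rewrite big_cons Hta ?Ht ?addr0 // => Hin; apply: Hal; apply: List.in_or_app; auto.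
Qed.

Definition pd_sum z (s : seq G) (W : G -> PD A M z) : PD A M z :=
  exist _ (fun al => \sum_(ga <- s) sval (W ga) al) (pd_sum_support z s W).

Lemma pd_decompose z (V : PD A M z) : exists s : seq G,
  [/\ uniq s, forall ga, ga \notin s -> sval V ga = 0
    & V = pd_sum z s (fun ga => pd_delta z ga (sval V ga))].
Proof.
case: (svalP V) => t Ht; have V0 ga : ga \notin undup t -> sval V ga = 0.
  by rewrite mem_undup => /notIn_mem /Ht.
exists (undup t); split; [exact: undup_uniq | exact: V0 | apply: PD_ext => al /=].
have [Hal|Hal] := boolP (al \in undup t).
  rewrite (bigD1_seq al) ?undup_uniq //= delta_fun_self big1 ?addr0 // => ga ne.
  exact: delta_fun_ne.
rewrite V0 // big1_seq // => ga /andP[_ Hga]; apply: delta_fun_ne.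
by apply: contraNneq Hal => <-.
Qed.

Definition shift_fun x y (c : G) (g : Hom C x (act A c y)) (v : PD A M y) (al : G) :
    mob M (act A al x) :=
  mmap M (castHom (Hom C) (erefl _) (actM c al y) (amap A al g)) (sval v (gmul al c)).

Lemma shift_fun_support x y c g v :
  exists s : seq G, forall al, ~ List.In al s -> shift_fun x y c g v al = 0.
Proof.
case: (svalP v) => t Ht; exists (map (gmul^~ (ginv c)) t) => al Hal.
rewrite /shift_fun Ht ?mmap0r // => /In_mem Hin; apply: Hal; apply/In_mem.
by rewrite -(gmulKr c al); exact: map_f.
Qed.

Definition pd_shift x y c g v : PD A M x :=
  exist _ (shift_fun x y c g v) (shift_fun_support x y c g v).
End Modules.

(* The morphism x -> y of R/G induced by g : x -> c y: its only nonzero entry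
   in row [al] is A_al g, in column [al c]. *)
Definition shift_hom_fun x y (c : G) (g : Hom C x (act A c y)) (al be : G) :
    Hom C (act A al x) (act A be y) :=
  if gmul al c =P be is ReflectT e then
    castHom (Hom C) (erefl _) (etrans (actM c al y) (f_equal (fun b => act A b y) e))
      (amap A al g)
  else 0.

Lemma shift_hom_funP x y c g :
  [/\ (forall be : G, exists s : list G, forall al, ~ List.In al s ->
         shift_hom_fun x y c g al be = 0),
      (forall al : G, exists s : list G, forall be, ~ List.In be s ->
         shift_hom_fun x y c g al be = 0) &
      (forall ga al be : G,
         shift_hom_fun x y c g (gmul ga al) (gmul ga be)
         = castHom (Hom C) (actM al ga x) (actM be ga y)
             (amap A ga (shift_hom_fun x y c g al be)))].
Proof.
rewrite /shift_hom_fun; split.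
- move=> be; exists [:: gmul be (ginv c)] => al /notIn_mem; rewrite inE => ne.
  by case: eqP => // e; rewrite -e gmulKr eqxx in ne.
- move=> al; exists [:: gmul al c] => be /notIn_mem; rewrite inE => ne.
  by case: eqP => // e; rewrite e eqxx in ne.
move=> ga al be.
case: (gmul (gmul ga al) c =P gmul ga be) => [e1|n1]; case: (gmul al c =P be) => [e2|n2].
- subst be; rewrite amap_castHom amapM !castHom_trans; exact: castHom_pi.
- by case: n2; apply: (@gmulI _ ga); rewrite gmulA.
- by case: n1; rewrite -gmulA e2.
- by rewrite amap0 castHom0.
Qed.

Definition shift_hom x y c g : rg_hom actM x y :=
  exist _ (shift_hom_fun x y c g) (shift_hom_funP x y c g).

Lemma pd_shiftE (M : rmod C) (HM : is_rmod M) x y c g v al :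
  FinSum (fun be => mmap M (sval (shift_hom x y c g) al be) (sval v be))
         (sval (pd_shift M HM x y c g v) al).
Proof.
suff -> : sval (pd_shift M HM x y c g v) al
          = mmap M (sval (shift_hom x y c g) al (gmul al c)) (sval v (gmul al c)).
  apply: FinSum1 => be ne; rewrite /= /shift_hom_fun.
  by case: eqP => [e|_]; [rewrite e eqxx in ne | exact: mmap0l].
rewrite /= /shift_hom_fun /shift_fun; case: eqP => [e|[]] //.
by congr (mmap M _ _); exact: castHom_pi.
Qed.

Section NaturalMaps.
Variables (X Y : rmod C) (HX : is_rmod X) (HY : is_rmod Y).
Variable u : forall x, PD A X x -> PD A Y x.
Hypothesis Hu : is_nat_PD actM X Y u.

Lemma nat_pd_shift x y c g v al :
  sval (u x (pd_shift X HX x y c g v)) al = sval (pd_shift Y HY x y c g (u y v)) al.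
Proof.
apply: FinSum_unique (pd_shiftE Y HY x y c g (u y v) al).
exact: (proj2 Hu) x y (shift_hom x y c g) v _ (pd_shiftE X HX x y c g v) al.
Qed.

Lemma nat_pd0 z (V : PD A X z) : (forall al, sval V al = 0) -> forall be, sval (u z V) be = 0.
Proof.
move=> V0 be.
have E ga : sval V ga = 1 *: sval V ga + sval V ga by rewrite V0 scaler0 addr0.
have := (proj1 Hu) z 1 V V V E be; rewrite scale1r => UV.
by apply: (@addrI _ (sval (u z V) be)); rewrite -UV addr0.
Qed.

Lemma nat_pd_sum z s W be :
  sval (u z (pd_sum X z s W)) be = \sum_(ga <- s) sval (u z (W ga)) be.
Proof.
elim: s => [|a s IH]; first by rewrite big_nil; apply: nat_pd0 => al; rewrite /= big_nil.
have E ga : sval (pd_sum X z (a :: s) W) ga = 1 *: sval (W a) ga + sval (pd_sum X z s W) ga.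
  by rewrite /= big_cons scale1r.
by rewrite ((proj1 Hu) z 1 _ _ _ E) scale1r IH big_cons.
Qed.

Lemma nat_pd_delta_sum z (V : PD A X z) be :
  FinSum (fun mu => sval (u z (pd_delta X z (ginv mu) (sval V (ginv mu)))) be)
         (sval (u z V) be).
Proof.
have [s [Us V0 EV]] := pd_decompose X z V.
have -> : sval (u z V) be = \sum_(ga <- s) sval (u z (pd_delta X z ga (sval V ga))) be.
  by rewrite -nat_pd_sum -EV.
apply/FinSumP; exists (map ginv s); split.
- by rewrite map_inj_uniq //; apply: can_inj (@ginvK G).
- move=> mu Hmu; apply: nat_pd0 => al /=; rewrite V0 ?delta_fun0 //.
  by apply: contra Hmu => Hs; rewrite -[mu]ginvK; exact: map_f.
- by rewrite big_map; apply: eq_bigr => ga _; rewrite ginvK.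
Qed.
End NaturalMaps.

Section F1Map.
Variables (X Y : rmod C) (HX : is_rmod X) (HY : is_rmod Y).
Variable f : forall mu : G, forall z, mob (twist A mu X) z -> mob Y z.
Hypothesis fnat : forall mu, is_nat (twist A mu X) Y (f mu).
Variable s : seq G.
Hypothesis s_uniq : uniq s.
Hypothesis f_support : forall mu, mu \notin s -> forall z w, f mu z w = 0.

Definition F1_fun x (v : PD A X x) (be : G) : mob Y (act A be x) :=
  \sum_(mu <- s) f mu (act A be x)
     (castT (mob X) (esym (actM be (ginv mu) x)) (sval v (gmul (ginv mu) be))).

Lemma F1_fun_support x v : exists r : seq G, forall be, ~ List.In be r -> F1_fun x v be = 0.
Proof.
case: (svalP v) => t Ht; exists [seq gmul mu b | mu <- s, b <- t] => be /notIn_mem Hbe.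
rewrite /F1_fun big1_seq // => mu /andP[_ Hmu].
rewrite Ht ?castT0 ?(lin0 (proj1 (fnat mu) _)) // => /In_mem Hin; case/negP: Hbe.
by rewrite -(gmulKV mu be); exact: allpairs_f.
Qed.

Definition F1_map x (v : PD A X x) : PD A Y x := exist _ (F1_fun x v) (F1_fun_support x v).

Lemma F1rel_F1_map : F1rel actM X Y f F1_map.
Proof. by move=> x v be; apply/FinSumP; exists s; split=> // mu /f_support ->. Qed.

Lemma F1_map_nat : is_nat_PD actM X Y F1_map.
Proof.
split.
  move=> x a v w z Hz ga /=; rewrite /F1_fun scaler_sumr -big_split; apply: eq_bigr => mu _.
  by rewrite Hz castT_linear; exact: (proj1 (fnat mu)).
(* Reindex the sum over [be] by [ginv mu], using the equivariance [Heq] of [h]. *)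
move=> x y h v w Hw al.
case: (svalP h) => _ /(_ al)[L HL] Heq.
have L0 be : be \notin undup L -> sval h al be = 0 by rewrite mem_undup => /notIn_mem/HL.
have hE ga be :
    mmap X (amap A ga (sval h al be)) (castT (mob X) (esym (actM be ga y)) (sval v (gmul ga be)))
    = castT (mob X) (esym (actM al ga x))
        (mmap X (sval h (gmul ga al) (gmul ga be)) (sval v (gmul ga be))).
  by rewrite Heq (mmap_castHom X) castT_trans castT_id.
have wE ga : sval w (gmul ga al)
    = \sum_(b <- map (gmul ga) (undup L)) mmap X (sval h (gmul ga al) b) (sval v b).
  apply: FinSum_unique (Hw (gmul ga al)) _; apply/FinSumP; exists (map (gmul ga) (undup L)).
  split=> //; first by rewrite map_inj_uniq ?undup_uniq //; exact: gmulI.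
  move=> b Hb; rewrite -(gmulKV ga b) Heq L0 ?amap0 ?castHom0 ?(mmap0l X HX) //.
  by apply: contra Hb => Hin; rewrite -[b](gmulKV ga); exact: map_f.
apply/FinSumP; exists (undup L); split; first exact: undup_uniq.
  by move=> be /L0 ->; rewrite (mmap0l Y HY).
rewrite /F1_fun; under [RHS]eq_bigr => be _ do rewrite (mmap_sumr Y HY).
rewrite exchange_big /= /F1_fun; apply: congr_big => // mu _.
have termE be : mmap Y (sval h al be)
      (f mu (act A be y) (castT (mob X) (esym (actM be (ginv mu) y)) (sval v (gmul (ginv mu) be))))
    = f mu (act A al x) (castT (mob X) (esym (actM al (ginv mu) x))
        (mmap X (sval h (gmul (ginv mu) al) (gmul (ginv mu) be)) (sval v (gmul (ginv mu) be)))).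
  by rewrite -hE; exact: esym ((proj2 (fnat mu)) _ _ _ _).
by rewrite (eq_bigr _ (fun be _ => termE be)) -(lin_sum (proj1 (fnat mu) _)) wE big_map castT_sum.
Qed.
End F1Map.

Lemma F1_exists (X Y : rmod C) : is_rmod X -> is_rmod Y ->
  forall f, in_dsum_hom A X Y f -> exists u, is_nat_PD actM X Y u /\ F1rel actM X Y f u.
Proof.
move=> HX HY f [fnat [s Hs]].
have f_support mu : mu \notin undup s -> forall z w, f mu z w = 0.
  by rewrite mem_undup => /notIn_mem/Hs.
exists (F1_map X Y f fnat (undup s)); split; first exact: F1_map_nat.
exact: F1rel_F1_map _ _ _ _ _ (undup_uniq s) f_support.
Qed.

Lemma F1rel_delta (X Y : rmod C) (f : forall mu : G, forall z, mob (twist A mu X) z -> mob Y z) u :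
  (forall mu, is_nat (twist A mu X) Y (f mu)) -> F1rel actM X Y f u ->
  forall x be mu (w : mob X (act A (gmul (ginv mu) be) x)),
  f mu (act A be x) (castT (mob X) (esym (actM be (ginv mu) x)) w)
  = sval (u x (pd_delta X x (gmul (ginv mu) be) w)) be.
Proof.
move=> fnat Hf x be mu w.
rewrite (FinSum1_eq (j := mu) _ (Hf x _ be)) /= ?delta_fun_self // => nu ne.
rewrite delta_fun_ne ?castT0 ?(lin0 (proj1 (fnat nu) _)) //.
by apply: contraNneq ne => /gmulIr/(can_inj (@ginvK G)) ->.
Qed.

Lemma F1_injective (X Y : rmod C) f g u :
  in_dsum_hom A X Y f -> in_dsum_hom A X Y g ->
  F1rel actM X Y f u -> F1rel actM X Y g u -> forall mu z w, f mu z w = g mu z w.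
Proof.
move=> [fnat _] [gnat _] Ff Fg mu z; rewrite -(act1 z) => w.
have -> : w = castT (mob X) (esym (actM gone (ginv mu) z))
                (castT (mob X) (actM gone (ginv mu) z) w) by rewrite castT_trans castT_id.
by rewrite (F1rel_delta X Y f u fnat Ff) (F1rel_delta X Y g u gnat Fg).
Qed.

Section F1Inverse.
Variables (X Y : rmod C) (HX : is_rmod X) (HY : is_rmod Y).
Variable u : forall x, PD A X x -> PD A Y x.
Hypothesis Hu : is_nat_PD actM X Y u.

Definition inv_F1 (mu : G) (z : Obj C) (w : mob (twist A mu X) z) : mob Y z :=
  castT (mob Y) (act1 z) (sval (u z (pd_delta X z (ginv mu) w)) gone).

Lemma F1rel_inv_F1 : F1rel actM X Y inv_F1 u.
Proof.
move=> x v be.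
have shiftE := nat_pd_shift X Y HX HY u Hu (act A be x) x be (idm (act A be x)) v gone.
rewrite /= /shift_fun amap_id (mmap_cast_idm Y HY) in shiftE.
have := FinSum_cast (act1 (act A be x))
  (nat_pd_delta_sum X Y u Hu _ (pd_shift X HX (act A be x) x be (idm _) v) gone).
apply: eq_FinSum.
  by move=> mu; rewrite /inv_F1 /= /shift_fun amap_id (mmap_cast_idm X HX).
rewrite shiftE castT_trans.
rewrite (@castT_dfun _ (mob Y) _ (fun c => act A c x) (sval (u x v)) _ _ (gmul1l be)).
exact: (@castT_pi _ (mob Y)).
Qed.

Lemma inv_F1_nat mu : is_nat (twist A mu X) Y (inv_F1 mu).
Proof.
split=> [z a v w | x y g v /=].
  have := (proj1 Hu) z a (pd_delta X z (ginv mu) v) (pd_delta X z (ginv mu) w)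
    (pd_delta X z (ginv mu) (a *: v + w)) (fun ga => delta_fun_linear X z (ginv mu) ga a v w).
  by rewrite /inv_F1 => ->; exact: castT_linear.
pose g' := castHom (Hom C) (erefl x) (esym (act1 y)) g.
have D : pd_delta X x (ginv mu) (mmap X (amap A (ginv mu) g) v)
         = pd_shift X HX x y gone g' (pd_delta X y (ginv mu) v).
  apply: PD_ext => al /=; rewrite /shift_fun pd_deltaE.
  rewrite (@castT_dfun _ (mob X) _ (fun c => act A c y) (delta_fun X y (ginv mu) v) _ _
             (esym (gmul1r al))).
  have [<-|ne] := eqVneq (ginv mu) al; last by rewrite !delta_fun_ne // castT0 (mmap0r X HX).
  rewrite !delta_fun_self /g' amap_castHom castHom_trans (mmap_castHom X).
  by rewrite castT_trans !castT_id.
rewrite /inv_F1 D (nat_pd_shift X Y HX HY u Hu) /= /shift_fun amap1 /g' !castHom_trans.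
rewrite (mmap_castHom Y) castT_trans castT_id.
rewrite (@castT_dfun _ (mob Y) _ (fun c => act A c y) (sval (u y (pd_delta X y (ginv mu) v)))
           _ _ (esym (gmul1l gone))) castT_trans.
by congr (mmap Y g _); exact: (@castT_pi _ (mob Y)).
Qed.

Lemma inv_F1_support :
  fg X -> exists s : seq G, forall mu, ~ List.In mu s -> forall z w, inv_F1 mu z w = 0.
Proof.
case=> n [xs [e He]].
have gen_support i : exists s : seq G, forall mu, mu \notin s ->
    inv_F1 mu (act A mu (xs i)) (castT (mob X) (esym (actVK mu (xs i))) (e i)) = 0.
  pose ei := castT (mob X) (esym (act1 (xs i))) (e i).
  have [s Hs] := svalP (u (xs i) (pd_delta X (xs i) gone ei)).
  exists s => mu /notIn_mem mu_s.
  have := F1rel_delta X Y inv_F1 u inv_F1_nat F1rel_inv_F1 (xs i) mu mu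
    (castT (fun c => mob X (act A c (xs i))) (esym (gmulVl mu)) ei).
  rewrite pd_delta_cast Hs // (@castT_fam _ (mob X) _ (fun c => act A c (xs i))) /ei.
  rewrite !castT_trans => <-.
  by congr (inv_F1 mu _ _); exact: (@castT_pi _ (mob X)).
have [S HS] := fin_all_exists gen_support.
exists (flatten [seq S i | i <- enum 'I_n]) => mu /notIn_mem Hmu z w.
have [fs ->] := He _ w.
rewrite (lin_sum (proj1 (inv_F1_nat mu) z)) big1 // => i _.
pose h := castHom (Hom C) (actKV mu z) (erefl _) (amap A mu (fs i)).
have -> : mmap X (fs i) (e i)
          = mmap (twist A mu X) h (castT (mob X) (esym (actVK mu (xs i))) (e i)).
  by rewrite /= amap_castHom amapVK castHom_trans (mmap_castHom X) !castT_trans !castT_id.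
rewrite (proj2 (inv_F1_nat mu)) HS ?(mmap0r Y HY) //.
by apply: contra Hmu => Hin; apply/flattenP; exists (S i) => //; apply: map_f; rewrite mem_enum.
Qed.

Lemma F1_surjective : fg X -> exists f, in_dsum_hom A X Y f /\ F1rel actM X Y f u.
Proof.
move=> fgX; exists inv_F1; split; last exact: F1rel_inv_F1.
by split; [exact: inv_F1_nat | exact: inv_F1_support].
Qed.
End F1Inverse.
End Pushdown.

Theorem mainTheorem6 (k : comPzRingType) (G : group) (C : kcat k) (A : Gaction G C)
  (actM : forall (al be : G) x, act A be (act A al x) = act A (gmul be al) x) :
  is_kcat C -> is_Gaction A actM ->
  forall X Y : rmod C, is_rmod X -> fg X -> is_rmod Y -> fg Y ->
  F1_bijective actM X Y.
Proof.
move=> _ [amap_linear amap_id _ [act1 amap1] amapM] X Y HX fgX HY _.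
by split; [apply: F1_exists | move=> u Hu; apply: F1_surjective | apply: F1_injective].
Qed.
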